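(* If $f\in C^{10}[0,1]$ and $x\in[0,1]$, then for sufficiently large $n$ we have $$\tilde D_n^{M,3}(f;x)-f(x)=\mathcal{O}\left(\frac{1}{n^3}\right).$$
   Context: For integers $n\ge 0$ and $k$, $p_{n,k}(x)=\binom{n}{k}x^k(1-x)^{n-k}$ for $0\le k\le n$, and $p_{n,k}(x)=0$ if $k<0$ or $k>n$. For $n\ge 4$ and $x\in[0,1]$ the operator $\tilde D_n^{M,3}$ is $$\tilde D_n^{M,3}(f;x)=(n+1)\sum_{k=0}^n p_{n,k}^{M,3}(x)\int_0^1 p_{n,k}(t)f(t)\,dt,$$ where $$p_{n,k}^{M,3}(x)=\tilde b(x,n)p_{n-4,k}(x)+\tilde d(x,n)p_{n-4,k-1}(x)+\tilde e(x,n)p_{n-4,k-2}(x)+\tilde d(1-x,n)p_{n-4,k-3}(x)+\tilde b(1-x,n)p_{n-4,k-4}(x),$$ with $\tilde b(x,n)=\sum_{i=0}^4\tilde b_i(n)x^i$, $\tilde d(x,n)=\sum_{i=0}^4\tilde d_i(n)x^i$, $\tilde e(x,n)=\tilde e_0(n)(x(1-x))^2$, and $$\tilde b_0(n)=\tfrac{10}{3},\quad \tilde b_1(n)=-\tfrac{53}{3}-\tfrac{11}{6}n,\quad \tilde b_2(n)=\tfrac12 n^2+\tfrac{29}{6}n+\tfrac{89}{3},\quad \tilde b_3(n)=-n^2-3n-16,\quad \tilde b_4(n)=\tfrac12 n^2,$$ $$\tilde d_0(n)=-\tfrac{10}{3},\quad \tilde d_1(n)=\tfrac{80}{3}+\tfrac{10}{3}n,\quad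 \tilde d_2(n)=-2n^2-\tfrac{28}{3}n-\tfrac{161}{3},\quad \tilde d_3(n)=4n^2+6n+32,\quad \tilde d_4(n)=-2n^2,$$ $$\tilde e_0(n)=3n^2.$$ *)

(* Defs.v *)
From Stdlib Require Import Reals ZArith.
From Coquelicot Require Import Coquelicot.
Open Scope R_scope.

Definition unit_interval (x : R) : Prop := 0 <= x <= 1.

(* f is k times continuously differentiable on the set D.  [D_in] and
   [continue_in] take limits within D, so on [0,1] the derivatives at the
   endpoints are one-sided and the values of f outside [0,1] are irrelevant. *)
Fixpoint Ck_on (k : nat) (D : R -> Prop) (f : R -> R) : Prop :=
  match k with
  | O => forall x, D x -> continue_in f D x
  | S k' => exists f' : R -> R,
      (forall x, D x -> D_in f f' D x) /\ Ck_on k' D f'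
  end.

(* The index k is an integer since p_(n-4,k-4) and the like occur with k < 4.
   [Binomial.C] is qualified because Coquelicot's [C] is the complex numbers;
   it is only meaningful for k <= n, which the test ensures. *)
Definition bern (n : nat) (k : Z) (x : R) : R :=
  if ((0 <=? k) && (k <=? Z.of_nat n))%Z%bool
  then Binomial.C n (Z.to_nat k) * x ^ Z.to_nat k * (1 - x) ^ (n - Z.to_nat k)
  else 0.

Definition b_coef (i n : nat) : R :=
  match i with
  | 0%nat => 10 / 3
  | 1%nat => - (53 / 3) - 11 / 6 * INR n
  | 2%nat => 1 / 2 * INR n ^ 2 + 29 / 6 * INR n + 89 / 3
  | 3%nat => - INR n ^ 2 - 3 * INR n - 16
  | 4%nat => 1 / 2 * INR n ^ 2
  | _ => 0
  end.

Definition d_coef (i n : nat) : R :=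
  match i with
  | 0%nat => - (10 / 3)
  | 1%nat => 80 / 3 + 10 / 3 * INR n
  | 2%nat => - 2 * INR n ^ 2 - 28 / 3 * INR n - 161 / 3
  | 3%nat => 4 * INR n ^ 2 + 6 * INR n + 32
  | 4%nat => - 2 * INR n ^ 2
  | _ => 0
  end.

Definition e0_coef (n : nat) : R := 3 * INR n ^ 2.

Definition b_poly (x : R) (n : nat) : R :=
  sum_f_R0 (fun i => b_coef i n * x ^ i) 4.

Definition d_poly (x : R) (n : nat) : R :=
  sum_f_R0 (fun i => d_coef i n * x ^ i) 4.

Definition e_poly (x : R) (n : nat) : R := e0_coef n * (x * (1 - x)) ^ 2.

(* Only meant for 4 <= n, since n - 4 is truncated. *)
Definition bern_M3 (n : nat) (k : Z) (x : R) : R :=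
  b_poly x n * bern (n - 4) k x
  + d_poly x n * bern (n - 4) (k - 1) x
  + e_poly x n * bern (n - 4) (k - 2) x
  + d_poly (1 - x) n * bern (n - 4) (k - 3) x
  + b_poly (1 - x) n * bern (n - 4) (k - 4) x.

Definition D_M3 (n : nat) (f : R -> R) (x : R) : R :=
  (INR n + 1) *
  sum_f_R0 (fun k => bern_M3 n (Z.of_nat k) x *
                     RInt (fun t => bern n (Z.of_nat k) t * f t) 0 1) n.

(* Main.v *)
Require Import Defs.
From Stdlib Require Import Reals ZArith List Lra Lia.
From Coquelicot Require Import Coquelicot.
Import ListNotations.
Open Scope R_scope.

(** Fix [x].  Regrouping the sum over [k] by the five shifts of the index writes
    the operator as the sum over [j <= 4] of [weight x n j * piece n j x g],
    where [weight] is quadratic in [n] and [piece n j x] is a positive operator: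
    the mean over a binomial variable [k] with parameters [n - 4] and [x] of the
    integral of [g] against the Beta density [(n + 1) * bern n (k + j)].

    Taylor's formula at [x] reduces the claim to the monomials [(t - x) ^ r]
    with [r <= 10] and to a remainder bounded by a multiple of [(t - x) ^ 10].
    Integration by parts gives a recurrence of order two for the central
    moments of the Beta densities ([beta_central_rec]).  After multiplication by
    [rising n r = (n + 2) ... (n + r + 1)] these moments are polynomials in
    [n], [x] and the index [k + j].  In the basis of falling factorials of [k]
    the binomial mean is immediate, because the mean of [falling k u] is
    [falling m u * x ^ u] ([bern_mean_falling]).  Hence the [r]-th central
    moment of the operator is an explicit polynomial in [n] and [x] divided by
    [6 * rising n r] ([D_M3_moment]).

    Since [rising n r >= n ^ r], this quotient is of order [n ^ -3] as soon as
    the numerator has degree at most [r - 3] in [n], in particular if it is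
    zero.  For [1 <= r <= 8] this is a cancellation among the five pieces, for which
    the coefficients of the weights were designed; it is checked by computing
    with coefficient lists ([moment_polys_gap3]).  The moment with [r = 0] is
    exactly 1.

    For the remainder no cancellation is available, since only its absolute
    value is controlled.  By positivity each piece of the remainder is at most
    a multiple of the tenth moment of that piece, which has order [n ^ -5],
    while the weights have order [n ^ 2] ([piece_polys_gap3]).  This is where
    ten derivatives come from: a remainder of lower degree would, after
    multiplication by the weights, no longer be bounded by the order [n ^ -3]. *)

(** * Sums *)

Lemma sum_scal_l (c : R) (u : nat -> R) (N : nat) :
  sum_f_R0 (fun k => c * u k) N = c * sum_f_R0 u N.
Proof. induction N as [|N IH]; simpl; [|rewrite IH]; ring. Qed.

(** The slack [d] allows sums with different shifts [j] to share one upper bound. *)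
Lemma sum_shift_vanishing (a : Z -> R) (G : nat -> R) (m : nat) :
  (forall k, (k < 0)%Z -> a k = 0) ->
  (forall k, (Z.of_nat m < k)%Z -> a k = 0) ->
  forall j d : nat,
  sum_f_R0 (fun k => a (Z.of_nat k - Z.of_nat j)%Z * G k) (m + d + j) =
  sum_f_R0 (fun k => a (Z.of_nat k) * G (k + j)%nat) m.
Proof.
intros Hneg Hpos j; revert G; induction j as [|j IH]; intros G d.
- rewrite Nat.add_0_r; induction d as [|d IHd].
  + rewrite Nat.add_0_r; apply sum_eq; intros k _.
    now rewrite Z.sub_0_r, Nat.add_0_r.
  + rewrite Nat.add_succ_r, tech5, IHd.
    rewrite (Hpos (_ - _)%Z) by lia; ring.
- rewrite Nat.add_succ_r, decomp_sum by lia; simpl pred.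
  rewrite (Hneg (_ - _)%Z) by lia.
  rewrite Rmult_0_l, Rplus_0_l.
  transitivity (sum_f_R0 (fun k => a (Z.of_nat k) * G (S (k + j))) m).
  + rewrite <- (IH (fun k => G (S k)) d).
    apply sum_eq; intros k _.
    now replace (Z.of_nat (S k) - Z.of_nat (S j))%Z
      with (Z.of_nat k - Z.of_nat j)%Z by lia.
  + apply sum_eq; intros k _; now rewrite Nat.add_succ_r.
Qed.

(** * Bernstein polynomials *)

Ltac solve_continuous :=
  intros; apply (@ex_derive_continuous R_AbsRing R_NormedModule);
  auto_derive; exact I.

Lemma bern_outside (n : nat) (k : Z) (x : R) :
  (k < 0)%Z \/ (Z.of_nat n < k)%Z -> bern n k x = 0.
Proof.
intros H; unfold bern.
destruct ((0 <=? k) && (k <=? Z.of_nat n))%Z%bool eqn:E; [|reflexivity].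
apply andb_prop in E; lia.
Qed.

Lemma bern_nat (n k : nat) (x : R) : (k <= n)%nat ->
  bern n (Z.of_nat k) x = Binomial.C n k * x ^ k * (1 - x) ^ (n - k).
Proof.
intros H; unfold bern; rewrite Nat2Z.id.
now replace ((0 <=? Z.of_nat k) && (Z.of_nat k <=? Z.of_nat n))%Z%bool with true
  by (symmetry; apply andb_true_intro; split; apply Z.leb_le; lia).
Qed.

Lemma binom_pos (n k : nat) : 0 < Binomial.C n k.
Proof.
unfold Binomial.C; apply Rdiv_lt_0_compat; [|apply Rmult_lt_0_compat]; apply INR_fact_lt_0.
Qed.

Lemma bern_ge0 (n : nat) (k : Z) (x : R) : 0 <= x <= 1 -> 0 <= bern n k x.
Proof.
intros Hx; unfold bern; destruct (_ && _)%bool; [|lra].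
pose proof (binom_pos n (Z.to_nat k)).
pose proof (pow_le x (Z.to_nat k) (proj1 Hx)).
pose proof (pow_le (1 - x) (n - Z.to_nat k) ltac:(lra)).
apply Rmult_le_pos; [apply Rmult_le_pos|]; lra.
Qed.

Lemma continuous_bern (n : nat) (k : Z) (t : R) : continuous (bern n k) t.
Proof.
unfold bern; destruct (_ && _)%bool; [|apply continuous_const].
solve_continuous.
Qed.

Lemma binom_n_n n : Binomial.C n n = 1.
Proof.
unfold Binomial.C; rewrite Nat.sub_diag; simpl (INR (fact 0)).
field; apply INR_fact_neq_0.
Qed.

Lemma binom_n_0 n : Binomial.C n 0 = 1.
Proof.
unfold Binomial.C; rewrite Nat.sub_0_r; simpl (INR (fact 0)).
field; apply INR_fact_neq_0.
Qed.

Lemma bern_succ (m k : nat) (x : R) : (k <= S m)%nat ->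
  bern (S m) (Z.of_nat k) x =
  x * bern m (Z.of_nat k - Z.of_nat 1) x + (1 - x) * bern m (Z.of_nat k) x.
Proof.
intros Hk; rewrite (bern_nat (S m)) by exact Hk.
destruct k as [|k].
- rewrite (bern_outside m (Z.of_nat 0 - Z.of_nat 1)) by lia.
  rewrite bern_nat, !binom_n_0, !Nat.sub_0_r by lia; simpl; ring.
- replace (Z.of_nat (S k) - Z.of_nat 1)%Z with (Z.of_nat k) by lia.
  rewrite (bern_nat m k) by lia; simpl (S m - S k)%nat.
  destruct (Nat.eq_dec k m) as [->|Hne].
  + rewrite (bern_outside m (Z.of_nat (S m))) by lia.
    rewrite !binom_n_n; simpl; ring.
  + rewrite bern_nat by lia.
    rewrite <- pascal by lia.
    replace (m - k)%nat with (S (m - S k)) by lia; simpl; ring.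
Qed.

(** * Binomial expectations of falling factorials *)

Definition bern_mean (m : nat) (x : R) (phi : nat -> R) : R :=
  sum_f_R0 (fun k => bern m (Z.of_nat k) x * phi k) m.

Lemma bern_mean_ext m x phi psi :
  (forall k, (k <= m)%nat -> phi k = psi k) ->
  bern_mean m x phi = bern_mean m x psi.
Proof.
intros H; apply sum_eq; intros k Hk; now rewrite H.
Qed.

Lemma bern_mean_plus m x phi psi :
  bern_mean m x (fun k => phi k + psi k) = bern_mean m x phi + bern_mean m x psi.
Proof.
unfold bern_mean; rewrite <- sum_plus; apply sum_eq; intros; ring.
Qed.

Lemma bern_mean_scal m x c phi :
  bern_mean m x (fun k => c * phi k) = c * bern_mean m x phi.
Proof.
unfold bern_mean; rewrite <- sum_scal_l; apply sum_eq; intros; ring.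
Qed.

Lemma bern_mean_abs_le m x phi psi : 0 <= x <= 1 ->
  (forall k, (k <= m)%nat -> Rabs (phi k) <= psi k) ->
  Rabs (bern_mean m x phi) <= bern_mean m x psi.
Proof.
intros Hx H; unfold bern_mean.
eapply Rle_trans; [apply Rsum_abs|].
apply sum_Rle; intros k Hk.
rewrite Rabs_mult, Rabs_pos_eq by now apply bern_ge0.
apply Rmult_le_compat_l; [now apply bern_ge0|auto].
Qed.

(** A binomial variable with [m + 1] trials, conditioned on its first trial. *)
Lemma bern_mean_succ m x phi :
  bern_mean (S m) x phi =
  x * bern_mean m x (fun k => phi (S k)) + (1 - x) * bern_mean m x phi.
Proof.
unfold bern_mean.
rewrite (sum_eq _ (fun k =>
    x * (bern m (Z.of_nat k - Z.of_nat 1) x * phi k)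
  + (1 - x) * (bern m (Z.of_nat k - Z.of_nat 0) x * phi k)))
  by (intros k Hk; rewrite bern_succ, Z.sub_0_r by exact Hk; ring).
rewrite sum_plus, !sum_scal_l.
assert (Hneg : forall k, (k < 0)%Z -> bern m k x = 0)
  by (intros; apply bern_outside; lia).
assert (Hpos : forall k, (Z.of_nat m < k)%Z -> bern m k x = 0)
  by (intros; apply bern_outside; lia).
pose proof (sum_shift_vanishing (fun k => bern m k x) phi m Hneg Hpos 1 0) as E1.
pose proof (sum_shift_vanishing (fun k => bern m k x) phi m Hneg Hpos 0 1) as E0.
replace (m + 0 + 1)%nat with (S m) in E1 by lia.
replace (m + 1 + 0)%nat with (S m) in E0 by lia.
cbv beta in E0, E1; rewrite E0, E1; f_equal; f_equal; apply sum_eq; intros k _.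
- now rewrite Nat.add_1_r.
- now rewrite Nat.add_0_r.
Qed.

Fixpoint falling (y : R) (u : nat) : R :=
  match u with
  | O => 1
  | S u' => falling y u' * (y - INR u')
  end.

Lemma falling_shift y u :
  falling (y + 1) (S u) = falling y (S u) + INR (S u) * falling y u.
Proof.
induction u as [|u IH]; [simpl; ring|].
change (falling (y + 1) (S (S u))) with (falling (y + 1) (S u) * (y + 1 - INR (S u))).
change (falling y (S (S u))) with (falling y (S u) * (y - INR (S u))).
rewrite IH; change (falling y (S u)) with (falling y u * (y - INR u)).
rewrite !S_INR; ring.
Qed.

(** Falling factorials diagonalise the binomial mean: by [falling_shift], passing
    from [m] to [m + 1] trials only adds the mean of [u * falling k (u - 1)],
    weighted by [x]. *)
Lemma bern_mean_falling m x u :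
  bern_mean m x (fun k => falling (INR k) u) = falling (INR m) u * x ^ u.
Proof.
revert u; induction m as [|m IH]; intros u.
- unfold bern_mean; simpl sum_f_R0; rewrite (bern_nat 0 0) by lia.
  rewrite binom_n_0; simpl.
  destruct u as [|u]; [simpl; ring|].
  assert (H : falling 0 (S u) = 0).
  { induction u as [|u IHu]; [simpl; ring|].
    change (falling 0 (S (S u))) with (falling 0 (S u) * (0 - INR (S u))).
    rewrite IHu; ring. }
  rewrite H; ring.
- rewrite bern_mean_succ.
  destruct u as [|u].
  + change (fun k => falling (INR (S k)) 0) with (fun k => falling (INR k) 0).
    rewrite (IH 0%nat); simpl; ring.
  + rewrite (bern_mean_ext m x (fun k => falling (INR (S k)) (S u))
      (fun k => falling (INR k) (S u) + INR (S u) * falling (INR k) u))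
      by (intros k _; rewrite (S_INR k); apply falling_shift).
    rewrite bern_mean_plus, bern_mean_scal, !IH, (S_INR m), falling_shift.
    simpl; ring.
Qed.

(** * Central moments of the Beta densities *)

Lemma ex_RInt_01 (g : R -> R) : (forall t, continuous g t) -> ex_RInt g 0 1.
Proof. intros H; apply (@ex_RInt_continuous R_CompleteNormedModule); auto. Qed.

Lemma RInt_ext_01 (g h : R -> R) :
  (forall t, 0 < t < 1 -> g t = h t) -> RInt g 0 1 = RInt h 0 1 :> R.
Proof.
intros H; apply RInt_ext; intros t; rewrite Rmin_left, Rmax_right by lra; apply H.
Qed.

Lemma RInt_lin (u v : R) (g h : R -> R) :
  ex_RInt g 0 1 -> ex_RInt h 0 1 ->
  RInt (fun t => u * g t + v * h t) 0 1 = u * RInt g 0 1 + v * RInt h 0 1 :> R.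
Proof.
intros Hg Hh; apply is_RInt_unique.
exact (is_RInt_plus _ _ _ _ _ _
  (is_RInt_scal _ _ _ u _ (@RInt_correct R_CompleteNormedModule _ _ _ Hg))
  (is_RInt_scal _ _ _ v _ (@RInt_correct R_CompleteNormedModule _ _ _ Hh))).
Qed.

Lemma RInt_derivative (F dF : R -> R) :
  (forall t, is_derive F t (dF t)) -> (forall t, continuous dF t) ->
  RInt dF 0 1 = F 1 - F 0 :> R.
Proof.
intros H1 H2; apply is_RInt_unique.
apply (@is_RInt_derive R_CompleteNormedModule); auto.
Qed.

(** The left-hand side is how [auto_derive] leaves the exponent of a power. *)
Lemma INR_S_unfold (a : nat) : (match a with O => 1 | S _ => INR a + 1 end) = INR (S a).
Proof. reflexivity. Qed.

(** Induction on [b]: the derivative of [t ^ (a + 1) * (1 - t) ^ (b + 1)] has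
    integral zero, which trades a factor [1 - t] for a factor [t]. *)
Lemma RInt_beta (a b : nat) :
  RInt (fun t => t ^ a * (1 - t) ^ b) 0 1 =
  INR (fact a) * INR (fact b) / INR (fact (a + b + 1)) :> R.
Proof.
revert a; induction b as [|b IH]; intros a.
- pose proof (RInt_derivative (fun t => t ^ S a / INR (S a))
                 (fun t => t ^ a * (1 - t) ^ 0)) as E.
  rewrite E.
  + replace (a + 0 + 1)%nat with (S a) by lia.
    rewrite pow1, pow_i by lia.
    rewrite fact_simpl, mult_INR; simpl (fact 0); simpl (INR 1).
    field; split; [apply INR_fact_neq_0|apply not_0_INR; lia].
  + intros t; auto_derive; [exact I|].
    rewrite INR_S_unfold.
    simpl pred; simpl ((1 - t) ^ 0); field; apply not_0_INR; lia.
  + solve_continuous.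
- assert (E : RInt (fun t => INR (S a) * (t ^ a * (1 - t) ^ S b)
                       + - INR (S b) * (t ^ S a * (1 - t) ^ b)) 0 1 = 0).
  { rewrite (RInt_derivative (fun t => t ^ S a * (1 - t) ^ S b)).
    - simpl; ring.
    - intros t; auto_derive; [exact I|].
      rewrite !INR_S_unfold, <- !tech_pow_Rmult; fold (1 - t); ring.
    - solve_continuous. }
  rewrite RInt_lin in E by (apply ex_RInt_01; solve_continuous).
  rewrite IH in E.
  apply Rmult_eq_reg_l with (INR (S a)); [|apply not_0_INR; lia].
  apply Rplus_eq_reg_r with
    (- INR (S b) * (INR (fact (S a)) * INR (fact b) / INR (fact (S a + b + 1)))).
  rewrite E.
  replace (a + S b + 1)%nat with (S a + b + 1)%nat by lia.
  rewrite (fact_simpl a), (fact_simpl b), !mult_INR.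
  field; apply INR_fact_neq_0.
Qed.

Fixpoint rising (n : R) (r : nat) : R :=
  match r with
  | O => 1
  | S r' => rising n r' * (n + INR r' + 2)
  end.

(** The [r]-th moment about [x] of the Beta density [(n + 1) * bern n i],
    multiplied by [rising n r] to clear its denominator. *)
Fixpoint beta_numer (n x : R) (r : nat) (i : R) : R :=
  match r with
  | O => 1
  | S r' =>
      (i - n * x + INR r * (1 - 2 * x)) * beta_numer n x r' i
      + INR r' * (n + INR r' + 1) * (x * (1 - x)) *
        match r' with O => 0 | S r'' => beta_numer n x r'' i end
  end.

(** Integrate the derivative of [t ^ (a + 1) * (1 - t) ^ (b + 1) * (t - x) ^ r],
    a function that vanishes at both ends, and expand [t] and [1 - t] around [x]. *)
Lemma beta_central_rec (a b r : nat) (x : R) :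
  (INR a + INR b + INR r + 2) * RInt (fun t => t ^ a * (1 - t) ^ b * (t - x) ^ S r) 0 1 =
  (INR a - (INR a + INR b) * x + INR (S r) * (1 - 2 * x))
    * RInt (fun t => t ^ a * (1 - t) ^ b * (t - x) ^ r) 0 1
  + INR r * (x * (1 - x)) * RInt (fun t => t ^ a * (1 - t) ^ b * (t - x) ^ pred r) 0 1.
Proof.
assert (E : RInt (fun t =>
    - (INR a + INR b + INR r + 2) * (t ^ a * (1 - t) ^ b * (t - x) ^ S r)
    + 1 * ((INR a - (INR a + INR b) * x + INR (S r) * (1 - 2 * x))
              * (t ^ a * (1 - t) ^ b * (t - x) ^ r)
           + INR r * (x * (1 - x)) * (t ^ a * (1 - t) ^ b * (t - x) ^ pred r))) 0 1 = 0).
{ rewrite (RInt_derivative (fun t => t ^ S a * (1 - t) ^ S b * (t - x) ^ r)).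
  - simpl; ring.
  - intros t; auto_derive; [exact I|].
    rewrite !INR_S_unfold; fold (1 - t); fold (t - x).
    destruct r as [|r]; simpl pred; rewrite <- !tech_pow_Rmult, !S_INR; simpl (INR 0); ring.
  - solve_continuous. }
rewrite 2!RInt_lin in E by (apply ex_RInt_01; solve_continuous).
lra.
Qed.

Lemma beta_central_moment (n i r : nat) (x : R) : (i <= n)%nat ->
  rising (INR n) r * ((INR n + 1) * RInt (fun t => bern n (Z.of_nat i) t * (t - x) ^ r) 0 1)
  = beta_numer (INR n) x r (INR i).
Proof.
intros Hi.
set (J r := RInt (fun t => t ^ i * (1 - t) ^ (n - i) * (t - x) ^ r) 0 1).
assert (EJ : forall r, RInt (fun t => bern n (Z.of_nat i) t * (t - x) ^ r) 0 1
               = Binomial.C n i * J r :> R).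
{ intros s; unfold J.
  rewrite (RInt_ext_01 _ (fun t => Binomial.C n i * (t ^ i * (1 - t) ^ (n - i) * (t - x) ^ s)
              + 0 * (t ^ i * (1 - t) ^ (n - i) * (t - x) ^ s)))
    by (intros t _; rewrite bern_nat by exact Hi; ring).
  rewrite RInt_lin by (apply ex_RInt_01; solve_continuous); ring. }
assert (Hrec : forall s, (INR n + INR s + 2) * J (S s) =
   (INR i - INR n * x + INR (S s) * (1 - 2 * x)) * J s
   + INR s * (x * (1 - x)) * J (pred s)).
{ intros s; pose proof (beta_central_rec i (n - i) s x) as E.
  replace (INR i + INR (n - i)) with (INR n) in E
    by (rewrite <- plus_INR; f_equal; lia).
  exact E. }
assert (H0 : (INR n + 1) * (Binomial.C n i * J O) = 1).
{ unfold J; rewrite (RInt_ext_01 _ (fun t => t ^ i * (1 - t) ^ (n - i)))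
    by (intros t _; simpl; ring).
  rewrite RInt_beta; unfold Binomial.C.
  replace (i + (n - i) + 1)%nat with (S n) by lia.
  rewrite fact_simpl, mult_INR, <- S_INR.
  field; repeat split; try apply INR_fact_neq_0; apply not_0_INR; lia. }
rewrite EJ.
(* The recurrence has order two, so two consecutive moments are carried along. *)
enough (H : forall s,
   rising (INR n) s * ((INR n + 1) * (Binomial.C n i * J s)) = beta_numer (INR n) x s (INR i)
   /\ rising (INR n) (S s) * ((INR n + 1) * (Binomial.C n i * J (S s)))
      = beta_numer (INR n) x (S s) (INR i)) by apply H.
intros s; induction s as [|s [IH1 IH2]].
- split; [simpl; rewrite H0; ring|].
  pose proof (Hrec O) as E; simpl in E |- *.
  transitivity ((INR n + 1) * Binomial.C n i * ((INR n + 0 + 2) * J 1%nat)); [ring|].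
  rewrite E.
  transitivity ((INR i - INR n * x + 1 * (1 - 2 * x)) *
    ((INR n + 1) * (Binomial.C n i * J 0%nat))); [ring|].
  rewrite H0; ring.
- split; [exact IH2|].
  change (beta_numer (INR n) x (S (S s)) (INR i)) with
    ((INR i - INR n * x + INR (S (S s)) * (1 - 2 * x)) * beta_numer (INR n) x (S s) (INR i)
     + INR (S s) * (INR n + INR (S s) + 1) * (x * (1 - x)) * beta_numer (INR n) x s (INR i)).
  rewrite <- IH1, <- IH2.
  pose proof (Hrec (S s)) as E; simpl pred in E.
  change (rising (INR n) (S (S s))) with (rising (INR n) (S s) * (INR n + INR (S s) + 2)).
  transitivity (rising (INR n) (S s) * (INR n + 1) * Binomial.C n i *
    ((INR n + INR (S s) + 2) * J (S (S s)))); [ring|].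
  rewrite E.
  change (rising (INR n) (S s)) with (rising (INR n) s * (INR n + INR s + 2)).
  rewrite !S_INR; ring.
Qed.


(** * Polynomials as coefficient lists *)

Section CoefficientLists.

Context {A : Type} (add : A -> A -> A) (mul : A -> A -> A) (zero : A).
Context (ev : A -> R) (y : R).
Context (ev_add : forall a b, ev (add a b) = ev a + ev b).
Context (ev_mul : forall a b, ev (mul a b) = ev a * ev b).
Context (ev_zero : ev zero = 0).

Fixpoint horner (p : list A) : R :=
  match p with
  | [] => 0
  | a :: p' => ev a + y * horner p'
  end.

Fixpoint padd (p q : list A) : list A :=
  match p, q with
  | [], _ => q
  | _, [] => p
  | a :: p', b :: q' => add a b :: padd p' q'
  end.

Fixpoint pmul (p q : list A) : list A :=
  match p with
  | [] => []
  | a :: p' => padd (map (mul a) q) (zero :: pmul p' q)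
  end.

Lemma horner_padd p q : horner (padd p q) = horner p + horner q.
Proof.
revert q; induction p as [|a p IH]; intros [|b q]; simpl; try ring.
rewrite ev_add, IH; ring.
Qed.

Lemma horner_map_mul a p : horner (map (mul a) p) = ev a * horner p.
Proof. induction p as [|b p IH]; simpl; [|rewrite ev_mul, IH]; ring. Qed.

Lemma horner_pmul p q : horner (pmul p q) = horner p * horner q.
Proof.
induction p as [|a p IH]; simpl; [ring|].
rewrite horner_padd, horner_map_mul; simpl; rewrite ev_zero, IH; ring.
Qed.

End CoefficientLists.

Definition xpoly := list Z.
Definition xadd : xpoly -> xpoly -> xpoly := padd Z.add.
Definition xmul : xpoly -> xpoly -> xpoly := pmul Z.add Z.mul 0%Z.
Definition xeval (x : R) : xpoly -> R := horner IZR x.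

(** Polynomials in [n] whose coefficients are integer polynomials in [x]. *)
Definition npoly := list xpoly.
Definition nadd : npoly -> npoly -> npoly := padd xadd.
Definition nmul : npoly -> npoly -> npoly := pmul xadd xmul [].
Definition neval (n x : R) : npoly -> R := horner (xeval x) n.

Lemma xeval_add x p q : xeval x (xadd p q) = xeval x p + xeval x q.
Proof. apply horner_padd, plus_IZR. Qed.

Lemma xeval_mul x p q : xeval x (xmul p q) = xeval x p * xeval x q.
Proof. apply horner_pmul; [apply plus_IZR|apply mult_IZR|reflexivity]. Qed.

Lemma neval_add n x p q : neval n x (nadd p q) = neval n x p + neval n x q.
Proof. apply horner_padd, xeval_add. Qed.

Lemma neval_mul n x p q : neval n x (nmul p q) = neval n x p * neval n x q.
Proof. apply horner_pmul; [apply xeval_add|apply xeval_mul|reflexivity]. Qed.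

Definition xzero (p : xpoly) : bool := forallb (Z.eqb 0) p.

Lemma xeval_xzero x p : xzero p = true -> xeval x p = 0.
Proof.
induction p as [|a p IH]; [reflexivity|]; intros H.
apply andb_prop in H; destruct H as [Ha Hp]; apply Z.eqb_eq in Ha; subst a.
change (xeval x (0%Z :: p)) with (0 + x * xeval x p); rewrite IH by exact Hp; ring.
Qed.

Lemma neval_xzero n x p : forallb xzero p = true -> neval n x p = 0.
Proof.
induction p as [|a p IH]; [reflexivity|]; intros H.
apply andb_prop in H; destruct H as [Ha Hp].
change (neval n x (a :: p)) with (xeval x a + n * neval n x p).
rewrite IH, xeval_xzero by assumption; ring.
Qed.

(** Degree at most [r - 3] in [n], with integer subtraction, so that only the zero
    polynomial passes when [r < 3].  The quotient of such a polynomial by one of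
    degree [r] is of order [n ^ -3]. *)
Fixpoint gap3 (r : nat) (p : npoly) : bool :=
  forallb xzero p ||
  match p with
  | [] => true
  | _ :: p' => (3 <=? r)%nat && gap3 (pred r) p'
  end.

Lemma gap3_bound (x : R) (p : npoly) (r : nat) : gap3 r p = true ->
  exists K, 0 <= K /\
    forall n, 1 <= n -> Rabs (neval n x p) * n ^ 3 <= K * n ^ r.
Proof.
revert r; induction p as [|a p IH]; intros r H; unfold gap3 in H; fold gap3 in H.
- exists 0; split; [lra|]; intros n _; change (neval n x []) with 0; rewrite Rabs_R0; lra.
- apply Bool.orb_prop in H; destruct H as [H|H].
  + exists 0; split; [lra|]; intros n _; rewrite neval_xzero, Rabs_R0 by exact H; lra.
  + apply andb_prop in H; destruct H as [Hr H]; apply Nat.leb_le in Hr.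
    destruct r as [|r]; [lia|]; simpl pred in H.
    destruct (IH r H) as [K [HK IHn]].
    exists (Rabs (xeval x a) + K); split; [pose proof (Rabs_pos (xeval x a)); lra|].
    intros n Hn; specialize (IHn n Hn).
    change (neval n x (a :: p)) with (xeval x a + n * neval n x p).
    assert (Hp : 0 <= n ^ 3) by (apply pow_le; lra).
    assert (Hle : n ^ 3 <= n ^ S r) by (apply Rle_pow; [lra|lia]).
    apply Rle_trans with ((Rabs (xeval x a) + n * Rabs (neval n x p)) * n ^ 3).
    * apply Rmult_le_compat_r; [exact Hp|].
      eapply Rle_trans; [apply Rabs_triang|].
      rewrite Rabs_mult, (Rabs_pos_eq n) by lra; lra.
    * pose proof (Rmult_le_compat_l _ _ _ (Rabs_pos (xeval x a)) Hle).
      pose proof (Rmult_le_compat_l n _ _ ltac:(lra) IHn).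
      rewrite <- (tech_pow_Rmult n r) in *; nra.
Qed.

(** * The moments as explicit polynomials *)

(** Polynomials in [k] in the basis of falling factorials, with coefficients
    in [npoly]. *)
Definition kpoly := list npoly.

(** The head of the list is the coefficient of [falling k u]; the induction over
    lists needs all starting points [u]. *)
Fixpoint kval (n x k : R) (u : nat) (p : kpoly) : R :=
  match p with
  | [] => 0
  | a :: p' => neval n x a * falling k u + kval n x k (S u) p'
  end.

Definition kadd : kpoly -> kpoly -> kpoly := padd nadd.

Lemma kval_add n x k u p q : kval n x k u (kadd p q) = kval n x k u p + kval n x k u q.
Proof.
revert u q; induction p as [|a p IH]; intros u [|b q]; simpl; try ring.
change (padd nadd p q) with (kadd p q); rewrite neval_add, IH; ring.
Qed.

Lemma kval_scal n x k u c p :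
  kval n x k u (map (nmul c) p) = neval n x c * kval n x k u p.
Proof.
revert u; induction p as [|a p IH]; intros u; simpl; [|rewrite neval_mul, IH]; ring.
Qed.

(** Multiplication by [k + l], since [k * falling k u = falling k (S u) + u * falling k u]. *)
Fixpoint ktimes (l : npoly) (u : nat) (p : kpoly) : kpoly :=
  match p with
  | [] => []
  | a :: p' =>
      kadd [nmul (nadd [[Z.of_nat u]] l) a; a] ([] :: ktimes l (S u) p')
  end.

Lemma kval_ktimes n x k l u p :
  kval n x k u (ktimes l u p) = (k + neval n x l) * kval n x k u p.
Proof.
revert u; induction p as [|a p IH]; intros u; [simpl; ring|].
change (ktimes l u (a :: p)) with
  (kadd [nmul (nadd [[Z.of_nat u]] l) a; a] ([] :: ktimes l (S u) p)).
rewrite kval_add; cbn [kval]; rewrite IH, neval_mul, neval_add.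
change (neval n x []) with 0.
replace (neval n x [[Z.of_nat u]]) with (INR u)
  by (unfold neval, xeval; simpl; rewrite INR_IZR_INZ; ring).
simpl falling; ring.
Qed.

(** The two coefficients of the recurrence that defines [beta_numer], for the
    index [k + j] and without the summand [k], which [ktimes] supplies. *)
Definition lin_coef (j r : Z) : npoly := [[j + r; - 2 * r]%Z; [0; -1]%Z].
Definition quad_coef (r : Z) : npoly :=
  [[0; r * (r + 1); - (r * (r + 1))]%Z; [0; r; - r]%Z].

Fixpoint numer_poly (j r : nat) : kpoly :=
  match r with
  | O => [[[1%Z]]]
  | S r' =>
      kadd (ktimes (lin_coef (Z.of_nat j) (Z.of_nat r)) 0 (numer_poly j r'))
        (map (nmul (quad_coef (Z.of_nat r')))
           match r' with O => [] | S r'' => numer_poly j r'' end)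
  end.

Lemma neval_lin_coef n x j r :
  neval n x (lin_coef (Z.of_nat j) (Z.of_nat r)) = INR j - n * x + INR r * (1 - 2 * x).
Proof.
unfold lin_coef, neval, xeval; cbn [horner].
rewrite plus_IZR, mult_IZR, <- !INR_IZR_INZ; ring.
Qed.

Lemma neval_quad_coef n x r :
  neval n x (quad_coef (Z.of_nat r)) = INR r * (n + INR r + 1) * (x * (1 - x)).
Proof.
unfold quad_coef, neval, xeval; cbn [horner].
rewrite !opp_IZR, mult_IZR, plus_IZR, <- !INR_IZR_INZ; ring.
Qed.

(** Both sides obey the same recurrence of order two. *)
Lemma numer_poly_correct n x j k r :
  kval n x (INR k) 0 (numer_poly j r) = beta_numer n x r (INR (k + j)).
Proof.
enough (H : kval n x (INR k) 0 (numer_poly j r) = beta_numer n x r (INR (k + j)) /\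
   kval n x (INR k) 0 (numer_poly j (S r)) = beta_numer n x (S r) (INR (k + j)))
  by apply H.
assert (step : forall r, kval n x (INR k) 0 (numer_poly j (S r)) =
   (INR k + (INR j - n * x + INR (S r) * (1 - 2 * x))) * kval n x (INR k) 0 (numer_poly j r)
   + INR r * (n + INR r + 1) * (x * (1 - x)) *
     kval n x (INR k) 0 match r with O => [] | S r'' => numer_poly j r'' end).
{ intros s; change (numer_poly j (S s)) with
   (kadd (ktimes (lin_coef (Z.of_nat j) (Z.of_nat (S s))) 0 (numer_poly j s))
        (map (nmul (quad_coef (Z.of_nat s)))
           match s with O => [] | S r'' => numer_poly j r'' end)).
  now rewrite kval_add, kval_ktimes, kval_scal, neval_lin_coef, neval_quad_coef. }
induction r as [|r [IH1 IH2]].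
- assert (H0 : kval n x (INR k) 0 (numer_poly j 0) = 1)
    by (unfold neval, xeval; simpl; unfold neval, xeval; simpl; ring).
  split; [exact H0|].
  rewrite step, H0; simpl; rewrite plus_INR; ring.
- split; [exact IH2|].
  rewrite step, IH1, IH2.
  change (beta_numer n x (S (S r)) (INR (k + j))) with
    ((INR (k + j) - n * x + INR (S (S r)) * (1 - 2 * x)) * beta_numer n x (S r) (INR (k + j))
     + INR (S r) * (n + INR (S r) + 1) * (x * (1 - x)) * beta_numer n x r (INR (k + j))).
  rewrite plus_INR; ring.
Qed.

(** The binomial mean replaces [falling k u] by [falling (n - 4) u * x ^ u].
    Consecutive values differ by the factor [(n - 4 - u) * x], so the sum can be
    evaluated by a Horner scheme. *)
Fixpoint kmean (u : Z) (p : kpoly) : npoly :=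
  match p with
  | [] => []
  | a :: p' => nadd a (nmul [[0; -4 - u]%Z; [0; 1]%Z] (kmean (Z.succ u) p'))
  end.

Lemma kmean_correct n x m u p : n = INR m + 4 ->
  bern_mean m x (fun k => kval n x (INR k) u p)
  = falling (INR m) u * x ^ u * neval n x (kmean (Z.of_nat u) p).
Proof.
intros Hn; revert u; induction p as [|a p IH]; intros u; simpl kval.
- rewrite (bern_mean_ext m x _ (fun k => 0 * 1)) by (intros; ring).
  rewrite bern_mean_scal; simpl; unfold neval; simpl; ring.
- rewrite bern_mean_plus, bern_mean_scal, bern_mean_falling, IH.
  change (kmean (Z.of_nat u) (a :: p)) with
    (nadd a (nmul [[0; -4 - Z.of_nat u]%Z; [0; 1]%Z] (kmean (Z.succ (Z.of_nat u)) p))).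
  rewrite neval_add, neval_mul, <- Nat2Z.inj_succ.
  unfold neval at 4, xeval; cbn [horner].
  rewrite minus_IZR, <- INR_IZR_INZ; simpl falling; simpl pow; rewrite Hn; ring.
Qed.

(** * The five pieces of the operator *)

Definition weight (x : R) (n j : nat) : R :=
  match j with
  | 0%nat => b_poly x n
  | 1%nat => d_poly x n
  | 2%nat => e_poly x n
  | 3%nat => d_poly (1 - x) n
  | 4%nat => b_poly (1 - x) n
  | _ => 0
  end.

Definition piece (n j : nat) (x : R) (g : R -> R) : R :=
  bern_mean (n - 4) x (fun k =>
    (INR n + 1) * RInt (fun t => bern n (Z.of_nat (k + j)) t * g t) 0 1).

(** The coefficient [weight x n j] multiplies [bern (n - 4) (k - j)]; shifting the
    summation index moves the shift into the density. *)
Lemma D_M3_pieces (n : nat) (g : R -> R) (x : R) : (4 <= n)%nat ->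
  D_M3 n g x = sum_f_R0 (fun j => weight x n j * piece n j x g) 4.
Proof.
intros Hn.
set (G := fun k : nat => (INR n + 1) * RInt (fun t => bern n (Z.of_nat k) t * g t) 0 1).
assert (E : forall j, (j <= 4)%nat ->
  sum_f_R0 (fun k => bern (n - 4) (Z.of_nat k - Z.of_nat j) x * G k) n = piece n j x g).
{ intros j Hj.
  pose proof (sum_shift_vanishing (fun k => bern (n - 4) k x) G (n - 4)
    ltac:(intros; apply bern_outside; lia)
    ltac:(intros; apply bern_outside; lia) j (4 - j)) as H.
  replace (n - 4 + (4 - j) + j)%nat with n in H by lia; exact H. }
unfold D_M3; rewrite <- sum_scal_l.
rewrite (sum_eq _ (fun k =>
    weight x n 0 * (bern (n - 4) (Z.of_nat k - Z.of_nat 0) x * G k)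
  + (weight x n 1 * (bern (n - 4) (Z.of_nat k - Z.of_nat 1) x * G k)
  + (weight x n 2 * (bern (n - 4) (Z.of_nat k - Z.of_nat 2) x * G k)
  + (weight x n 3 * (bern (n - 4) (Z.of_nat k - Z.of_nat 3) x * G k)
  + weight x n 4 * (bern (n - 4) (Z.of_nat k - Z.of_nat 4) x * G k)))))).
- rewrite !sum_plus, !sum_scal_l, !E by lia; cbn [sum_f_R0]; ring.
- intros k _; unfold bern_M3, G, weight; rewrite Z.sub_0_r.
  change (Z.of_nat 1) with 1%Z; change (Z.of_nat 2) with 2%Z.
  change (Z.of_nat 3) with 3%Z; change (Z.of_nat 4) with 4%Z; ring.
Qed.

(** The weights are scaled by 6 to have integer coefficients; the arguments
    [1 - x] of the last two are expanded in powers of [x]. *)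
Definition weight_poly (j : nat) : npoly :=
  match j with
  | 0%nat => [[20; -106; 178; -96]; [0; -11; 29; -18]; [0; 0; 3; -6; 3]]%Z
  | 1%nat => [[-20; 160; -322; 192]; [0; 20; -56; 36]; [0; 0; -12; 24; -12]]%Z
  | 2%nat => [[]; []; [0; 0; 18; -36; 18]]%Z
  | 3%nat => [[10; -92; 254; -192]; [0; -16; 52; -36]; [0; 0; -12; 24; -12]]%Z
  | 4%nat => [[-4; 38; -110; 96]; [0; 7; -25; 18]; [0; 0; 3; -6; 3]]%Z
  | _ => []
  end.

Lemma weight_poly_correct x n j :
  neval (INR n) x (weight_poly j) = 6 * weight x n j.
Proof.
unfold neval, xeval.
destruct j as [|[|[|[|[|j]]]]];
  unfold weight, weight_poly, b_poly, d_poly, e_poly, e0_coef;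
  cbn [horner sum_f_R0 b_coef d_coef]; field.
Qed.

Definition piece_poly (r j : nat) : npoly :=
  nmul (weight_poly j) (kmean 0 (numer_poly j r)).

Lemma piece_moment n j r x : (4 <= n)%nat -> (j <= 4)%nat ->
  6 * rising (INR n) r * (weight x n j * piece n j x (fun t => (t - x) ^ r))
  = neval (INR n) x (piece_poly r j).
Proof.
intros Hn Hj; unfold piece_poly; rewrite neval_mul, weight_poly_correct.
assert (E : rising (INR n) r * piece n j x (fun t => (t - x) ^ r)
  = neval (INR n) x (kmean 0 (numer_poly j r))).
{ unfold piece; rewrite <- bern_mean_scal.
  rewrite (bern_mean_ext _ _ _ (fun k => kval (INR n) x (INR k) 0 (numer_poly j r))).
  - rewrite (kmean_correct (INR n) x (n - 4)); [simpl; ring|].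
    rewrite minus_INR by exact Hn; simpl; ring.
  - intros k Hk; rewrite numer_poly_correct, <- beta_central_moment by lia.
    reflexivity. }
rewrite <- E; ring.
Qed.

Definition moment_poly (r : nat) : npoly :=
  fold_right (fun j => nadd (piece_poly r j)) [] (seq 0 5).

Lemma D_M3_moment n r x : (4 <= n)%nat ->
  6 * rising (INR n) r * D_M3 n (fun t => (t - x) ^ r) x
  = neval (INR n) x (moment_poly r).
Proof.
intros Hn; rewrite D_M3_pieces by exact Hn.
unfold moment_poly; cbn [fold_right seq sum_f_R0].
rewrite !neval_add, <- !piece_moment by (exact Hn || lia).
change (neval (INR n) x []) with 0; ring.
Qed.

(** The cancellation that gives the operator its order; for [r = 1] and
    [r = 2] it has to be complete. *)
Lemma moment_polys_gap3 r : (1 <= r <= 10)%nat -> gap3 r (moment_poly r) = true.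
Proof.
intros Hr.
assert (H : forallb (fun s => gap3 s (moment_poly s)) (seq 1 10) = true)
  by (vm_compute; reflexivity).
rewrite forallb_forall in H; apply H, in_seq; lia.
Qed.

(** Each tenth moment alone has degree 5 in [n] before division by [rising n 10],
    and the weight adds 2, so the bound 7 holds piece by piece. *)
Lemma piece_polys_gap3 j : (j <= 4)%nat -> gap3 10 (piece_poly 10 j) = true.
Proof.
intros Hj.
assert (H : forallb (fun s => gap3 10 (piece_poly 10 s)) (seq 0 5) = true)
  by (vm_compute; reflexivity).
rewrite forallb_forall in H; apply H, in_seq; lia.
Qed.


(** * Quantities of order n^-3 *)

Definition cubic (u : nat -> R) : Prop :=
  exists K, forall n : nat, (4 <= n)%nat -> Rabs (u n) <= K * (1 / INR n ^ 3).

Lemma cubic_lin (c : R) (u v : nat -> R) :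
  cubic u -> cubic v -> cubic (fun n => c * u n + v n).
Proof.
intros [K HK] [L HL]; exists (Rabs c * K + L); intros n Hn.
specialize (HK n Hn); specialize (HL n Hn).
eapply Rle_trans; [apply Rabs_triang|]; rewrite Rabs_mult.
pose proof (Rmult_le_compat_l _ _ _ (Rabs_pos c) HK); lra.
Qed.

Lemma cubic_le (u v : nat -> R) :
  (forall n, (4 <= n)%nat -> Rabs (u n) <= v n) -> cubic v -> cubic u.
Proof.
intros H [K HK]; exists K; intros n Hn.
eapply Rle_trans; [now apply H|].
eapply Rle_trans; [apply Rle_abs|now apply HK].
Qed.

Lemma cubic_sum (u : nat -> nat -> R) (N : nat) :
  (forall j, (j <= N)%nat -> cubic (u j)) ->
  cubic (fun n => sum_f_R0 (fun j => u j n) N).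
Proof.
induction N as [|N IH]; intros H; [now apply H|].
destruct (cubic_lin 1 _ _ (H (S N) (le_n _)) (IH ltac:(intros; apply H; lia))) as [K HK].
exists K; intros n Hn; specialize (HK n Hn); cbv beta in HK.
rewrite tech5, Rplus_comm, <- (Rmult_1_l (u (S N) n)); exact HK.
Qed.

Lemma rising_ge_pow (n : R) (r : nat) : 0 <= n -> n ^ r <= rising n r.
Proof.
intros Hn; induction r as [|r IH]; simpl; [lra|].
pose proof (pow_le n r Hn); pose proof (pos_INR r).
rewrite Rmult_comm; apply Rmult_le_compat; lra.
Qed.

Lemma gap3_cubic (x : R) (p : npoly) (r : nat) (u : nat -> R) :
  gap3 r p = true ->
  (forall n, (4 <= n)%nat -> 6 * rising (INR n) r * u n = neval (INR n) x p) ->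
  cubic u.
Proof.
intros Hp Hu; destruct (gap3_bound x p r Hp) as [K [HK H]].
exists K; intros n Hn; specialize (Hu n Hn).
assert (Hn1 : 1 <= INR n) by (apply (le_INR 1); lia).
specialize (H (INR n) Hn1).
pose proof (rising_ge_pow (INR n) r ltac:(lra)) as Hr.
pose proof (pow_lt (INR n) r ltac:(lra)).
pose proof (pow_lt (INR n) 3 ltac:(lra)) as H3.
rewrite <- Hu, !Rabs_mult, (Rabs_pos_eq 6), (Rabs_pos_eq (rising _ _)) in H by lra.
replace (K * (1 / INR n ^ 3)) with (K / INR n ^ 3) by (field; lra).
apply Rle_div_r; [exact H3|].
apply Rmult_le_reg_l with (rising (INR n) r); [lra|].
pose proof (Rmult_le_compat_l K _ _ HK Hr).
pose proof (Rmult_le_pos _ _ (Rabs_pos (u n)) (Rlt_le _ _ H3)).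
pose proof (Rmult_le_pos (rising (INR n) r) (Rabs (u n) * INR n ^ 3) ltac:(lra) ltac:(lra)).
lra.
Qed.

(** * The operator on continuous functions *)

Lemma ex_RInt_bern (n : nat) (k : Z) (g : R -> R) :
  (forall t, continuous g t) -> ex_RInt (fun t => bern n k t * g t) 0 1.
Proof.
intros Hg; apply ex_RInt_01; intros t.
apply (@continuous_mult R_UniformSpace R_AbsRing); [apply continuous_bern|apply Hg].
Qed.

Lemma D_M3_ext (n : nat) (g h : R -> R) (x : R) :
  (forall t, 0 < t < 1 -> g t = h t) -> D_M3 n g x = D_M3 n h x.
Proof.
intros H; unfold D_M3; f_equal; apply sum_eq; intros k _; f_equal.
apply RInt_ext_01; intros t Ht; now rewrite H.
Qed.

Lemma D_M3_lin (n : nat) (c : R) (g h : R -> R) (x : R) :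
  (forall t, continuous g t) -> (forall t, continuous h t) ->
  D_M3 n (fun t => c * g t + h t) x = c * D_M3 n g x + D_M3 n h x.
Proof.
intros Hg Hh; unfold D_M3.
rewrite (sum_eq _ (fun k =>
    c * (bern_M3 n (Z.of_nat k) x * RInt (fun t => bern n (Z.of_nat k) t * g t) 0 1)
    + bern_M3 n (Z.of_nat k) x * RInt (fun t => bern n (Z.of_nat k) t * h t) 0 1)).
- rewrite sum_plus, sum_scal_l; ring.
- intros k _.
  rewrite (RInt_ext_01 _ (fun t => c * (bern n (Z.of_nat k) t * g t)
                              + 1 * (bern n (Z.of_nat k) t * h t)))
    by (intros; ring).
  rewrite RInt_lin by now apply ex_RInt_bern.
  ring.
Qed.

(** Each piece is a positive operator, although the weights have no sign. *)
Lemma piece_abs_le (n j : nat) (x K : R) (g h : R -> R) :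
  (4 <= n)%nat -> 0 <= x <= 1 ->
  (forall t, continuous g t) -> (forall t, continuous h t) ->
  (forall t, 0 <= t <= 1 -> Rabs (g t) <= K * h t) ->
  Rabs (piece n j x g) <= K * piece n j x h.
Proof.
intros Hn Hx Hg Hh H; unfold piece; rewrite <- bern_mean_scal.
apply bern_mean_abs_le; [exact Hx|]; intros k _.
pose proof (pos_INR n).
rewrite Rabs_mult, Rabs_pos_eq by lra.
set (I := RInt (fun t => bern n (Z.of_nat (k + j)) t * h t) 0 1).
replace (K * ((INR n + 1) * I)) with ((INR n + 1) * (K * I + 0 * I)) by ring.
apply Rmult_le_compat_l; [lra|].
unfold I; rewrite <- RInt_lin by now apply ex_RInt_bern.
apply (@norm_RInt_le R_NormedModule (fun t => bern n (Z.of_nat (k + j)) t * g t)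
  (fun t => K * (bern n (Z.of_nat (k + j)) t * h t)
            + 0 * (bern n (Z.of_nat (k + j)) t * h t)) 0 1); [lra| | |].
- intros t Ht; change (norm (bern n (Z.of_nat (k + j)) t * g t))
    with (Rabs (bern n (Z.of_nat (k + j)) t * g t)).
  pose proof (bern_ge0 n (Z.of_nat (k + j)) t Ht) as Hb.
  rewrite Rabs_mult, (Rabs_pos_eq (bern _ _ _)) by exact Hb.
  pose proof (Rmult_le_compat_l _ _ _ Hb (H t Ht)); lra.
- apply (@RInt_correct R_CompleteNormedModule); now apply ex_RInt_bern.
- apply (@RInt_correct R_CompleteNormedModule).
  apply (@ex_RInt_plus R_NormedModule);
    apply (@ex_RInt_scal R_NormedModule); now apply ex_RInt_bern.
Qed.

(** The weights add up to 1. *)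
Lemma D_M3_one (n : nat) (x : R) : (4 <= n)%nat -> D_M3 n (fun t => (t - x) ^ 0) x = 1.
Proof.
intros Hn; pose proof (D_M3_moment n 0 x Hn) as E; simpl rising in E.
assert (H : neval (INR n) x (nadd (moment_poly 0) [[-6]]%Z) = 0)
  by (apply neval_xzero; vm_compute; reflexivity).
rewrite neval_add, <- E in H.
replace (neval (INR n) x [[-6]]%Z) with (-6) in H by (unfold neval, xeval; simpl; ring).
lra.
Qed.

Lemma D_M3_moment_cubic (r : nat) (x : R) : (1 <= r <= 10)%nat ->
  cubic (fun n => D_M3 n (fun t => (t - x) ^ r) x).
Proof.
intros Hr; apply (gap3_cubic x (moment_poly r) r); [now apply moment_polys_gap3|].
intros n Hn; now apply D_M3_moment.
Qed.

(** The weights change sign, so the pieces are estimated one at a time. *)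
Lemma D_M3_remainder_cubic (x K : R) (g : R -> R) : 0 <= x <= 1 ->
  (forall t, continuous g t) ->
  (forall t, 0 <= t <= 1 -> Rabs (g t) <= K * (t - x) ^ 10) ->
  cubic (fun n => D_M3 n g x).
Proof.
intros Hx Hg H.
assert (Hpow : forall t, continuous (fun t => (t - x) ^ 10) t) by solve_continuous.
apply cubic_le with (fun n => sum_f_R0 (fun j =>
   Rabs K * Rabs (weight x n j * piece n j x (fun t => (t - x) ^ 10)) + 0) 4).
- intros n Hn; rewrite D_M3_pieces by exact Hn.
  eapply Rle_trans; [apply Rsum_abs|]; apply sum_Rle; intros j Hj.
  rewrite Rplus_0_r, !Rabs_mult, <- Rmult_assoc, (Rmult_comm (Rabs K)), Rmult_assoc.
  apply Rmult_le_compat_l; [apply Rabs_pos|].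
  rewrite <- Rabs_mult; eapply Rle_trans; [|apply Rle_abs].
  now apply piece_abs_le.
- apply cubic_sum; intros j Hj.
  apply (cubic_lin _ (fun n => Rabs (weight x n j * piece n j x (fun t => (t - x) ^ 10)))).
  + apply cubic_le with (fun n => Rabs (weight x n j * piece n j x (fun t => (t - x) ^ 10))).
    { intros n _; rewrite Rabs_Rabsolu; lra. }
    destruct (gap3_cubic x (piece_poly 10 j) 10
       (fun n => weight x n j * piece n j x (fun t => (t - x) ^ 10))
       (piece_polys_gap3 j Hj)) as [L HL].
    * intros n Hn; now apply piece_moment.
    * exists L; intros n Hn; rewrite Rabs_Rabsolu; now apply HL.
  + exists 0; intros n _; rewrite Rabs_R0; lra.
Qed.

(** * Taylor's formula on the unit interval *)

(** Composition with [clamp] extends a function from the unit interval to a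
    continuous function on the line, which turns one-sided limits at the end
    points into the two-sided ones that integration and the mean value theorem
    ask for. *)
Definition clamp (t : R) : R := Rmax 0 (Rmin 1 t).

Lemma clamp_in t : unit_interval (clamp t).
Proof.
unfold unit_interval, clamp; split; [apply Rmax_l|].
apply Rmax_lub; [lra|apply Rmin_l].
Qed.

Lemma clamp_id t : 0 <= t <= 1 -> clamp t = t.
Proof. intros H; unfold clamp; rewrite Rmin_right, Rmax_right; lra. Qed.

Lemma clamp_dist s t : Rabs (clamp s - clamp t) <= Rabs (s - t).
Proof.
unfold clamp, Rmax, Rmin; repeat destruct (Rle_dec _ _);
  unfold Rabs; repeat destruct (Rcase_abs _); lra.
Qed.

Lemma continuous_clamp (f : R -> R) :
  (forall t, unit_interval t -> continue_in f unit_interval t) ->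
  forall t, continuity_pt (fun s => f (clamp s)) t.
Proof.
intros Hf t eps Heps.
destruct (Hf (clamp t) (clamp_in t) eps Heps) as [d [Hd H]].
exists d; split; [exact Hd|]; intros s [_ Hs].
destruct (Req_dec (clamp s) (clamp t)) as [->|Hne].
- simpl; unfold Rdist; rewrite Rminus_diag, Rabs_R0; exact Heps.
- apply H; split; [split; [apply clamp_in|exact (not_eq_sym Hne)]|].
  eapply Rle_lt_trans; [apply clamp_dist|exact Hs].
Qed.

Lemma is_derive_clamp (f f' : R -> R) (t : R) :
  D_in f f' unit_interval t -> 0 < t < 1 ->
  is_derive (fun s => f (clamp s)) t (f' t).
Proof.
intros Hf Ht; apply is_derive_Reals; intros eps Heps.
destruct (Hf eps Heps) as [d [Hd H]].
assert (Hpos : 0 < Rmin d (Rmin t (1 - t))) by (repeat apply Rmin_glb_lt; lra).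
exists (mkposreal _ Hpos); intros h Hh0 Hh; simpl in Hh.
pose proof (Rmin_l d (Rmin t (1 - t))); pose proof (Rmin_r d (Rmin t (1 - t))).
pose proof (Rmin_l t (1 - t)); pose proof (Rmin_r t (1 - t)).
assert (- Rabs h <= h <= Rabs h)
  by (unfold Rabs; destruct (Rcase_abs h); lra).
rewrite !clamp_id by lra.
specialize (H (t + h)); simpl in H; unfold Rdist in H.
replace (t + h - t) with h in H by ring.
apply H; repeat split; try lra.
Qed.

Lemma Ck_on_continue_in (k : nat) (D : R -> Prop) (f : R -> R) (t : R) :
  Ck_on k D f -> D t -> continue_in f D t.
Proof.
destruct k as [|k]; simpl; [intros H; apply H|].
intros [f' [H _]] Ht; exact (cont_deriv _ _ _ _ (H t Ht)).
Qed.

(** Induction on [k]: the Taylor polynomial of [f] is [f x] plus the primitive of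
    that of [f'], and the mean value theorem turns the bound for the derivative
    of the difference into one more power of [Rabs (t - x)].  The sum runs up to
    the power [k], whose coefficient only affects the constant [K]; thus the
    start [k = 0] of the induction has a term [a 0] and is the boundedness of
    [f]. *)
Lemma taylor_unit_interval (k : nat) (f : R -> R) (x : R) :
  Ck_on k unit_interval f -> 0 <= x <= 1 ->
  exists (a : nat -> R) (K : R), a O = f x /\ 0 <= K /\
    forall t, 0 <= t <= 1 ->
      Rabs (f t - sum_f_R0 (fun r => a r * (t - x) ^ r) k) <= K * Rabs (t - x) ^ k.
Proof.
intros Hf Hx; revert f Hf; induction k as [|k IH]; intros f Hf.
- destruct (continuity_ab_maj (fun t => Rabs (f (clamp t) - f x)) 0 1 ltac:(lra)) as [M [HM _]].
  { intros c _; apply (continuity_pt_comp (fun t => f (clamp t) - f x) Rabs);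
      [|apply Rcontinuity_abs].
    apply continuity_pt_minus; [now apply continuous_clamp|].
    apply continuity_pt_const; intros y z; reflexivity. }
  exists (fun _ => f x), (Rabs (f (clamp M) - f x)).
  split; [reflexivity|]; split; [apply Rabs_pos|].
  intros t Ht; specialize (HM t Ht); cbv beta in HM; rewrite clamp_id in HM by exact Ht.
  simpl; rewrite !Rmult_1_r; exact HM.
- destruct Hf as [f' [Hd Hf']].
  destruct (IH f' Hf') as [a [K [_ [HK H]]]].
  exists (fun r => match r with O => f x | S r' => a r' / INR (S r') end), K.
  split; [reflexivity|]; split; [exact HK|]; intros t Ht.
  set (P := fun s => sum_f_R0 (fun r => a r / INR (S r) * (s - x) ^ S r) k).
  rewrite decomp_sum by lia; simpl pred.
  assert (HP : forall s, is_derive P s (sum_f_R0 (fun r => a r * (s - x) ^ r) k)).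
  { intros s.
    assert (Hterm : forall r, is_derive (fun s => a r / INR (S r) * (s - x) ^ S r) s
                                (a r * (s - x) ^ r)).
    { intros r; auto_derive; [exact I|].
      rewrite INR_S_unfold; simpl pred; fold (s - x).
      field; apply not_0_INR; lia. }
    unfold P; clear - Hterm; induction k as [|k IHk]; [apply Hterm|].
    apply (@is_derive_plus R_AbsRing R_NormedModule); [exact IHk|apply Hterm]. }
  destruct (MVT_gen (fun s => f (clamp s) - P s) x t
     (fun s => f' s - sum_f_R0 (fun r => a r * (s - x) ^ r) k)) as [c [Hc E]].
  + intros s Hs; apply (@is_derive_minus R_AbsRing R_NormedModule); [|apply HP].
    pose proof (Rmin_glb x t 0 ltac:(lra) ltac:(lra)).
    pose proof (Rmax_lub x t 1 ltac:(lra) ltac:(lra)).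
    apply is_derive_clamp; [apply Hd; red|]; lra.
  + intros s _; apply continuity_pt_minus.
    * apply continuous_clamp; intros y Hy; exact (cont_deriv _ _ _ _ (Hd y Hy)).
    * apply continuity_pt_filterlim.
      apply (@ex_derive_continuous R_AbsRing R_NormedModule); eexists; apply HP.
  + cbv beta in E; rewrite !clamp_id in E by assumption.
    assert (HPx : P x = 0).
    { unfold P; rewrite (sum_eq _ (fun r => 0 * 1))
        by (intros; simpl; unfold Rminus; rewrite Rplus_opp_r; ring).
      rewrite sum_scal_l; ring. }
    rewrite HPx in E.
    replace (f t - _) with ((f' c - sum_f_R0 (fun r => a r * (c - x) ^ r) k) * (t - x))
      by (unfold P in E; simpl pow at 2; lra).
    rewrite Rabs_mult, <- tech_pow_Rmult, (Rmult_comm (Rabs (t - x))), <- Rmult_assoc.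
    apply Rmult_le_compat_r; [apply Rabs_pos|].
    pose proof (Rmin_glb x t 0 ltac:(lra) ltac:(lra)).
    pose proof (Rmax_lub x t 1 ltac:(lra) ltac:(lra)).
    eapply Rle_trans; [apply H; lra|].
    apply Rmult_le_compat_l; [exact HK|]; apply pow_incr; split; [apply Rabs_pos|].
    revert Hc; unfold Rmin, Rmax, Rabs; destruct (Rle_dec x t);
      repeat destruct (Rcase_abs _); lra.
Qed.

(** * Convergence *)

Theorem theorem4p1 :
  forall (f : R -> R) (x : R),
    Ck_on 10 unit_interval f ->
    0 <= x <= 1 ->
    exists (M : R) (N : nat),
      (4 <= N)%nat /\
      forall n : nat, (N <= n)%nat ->
        Rabs (D_M3 n f x - f x) <= M * (1 / INR n ^ 3).
Proof.
intros f x Hf Hx.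
destruct (taylor_unit_interval 10 f x Hf Hx) as [a [K [Ha [_ HT]]]].
set (P := fun t => sum_f_R0 (fun r => a (S r) * (t - x) ^ S r) 9).
(* The remainder uses the clamped [f]: [f] itself is arbitrary off [0,1]. *)
set (rem := fun t => f (clamp t) - (a O + P t)).
assert (HPc : forall N t, continuous (fun t => sum_f_R0 (fun r => a (S r) * (t - x) ^ S r) N) t).
{ intros N; induction N as [|N IH]; intros t; [simpl; solve_continuous|].
  apply (@continuous_plus R_UniformSpace R_AbsRing R_NormedModule); [apply IH|solve_continuous]. }
assert (Hrem : forall t, continuous rem t).
{ intros t; apply (@continuous_minus R_UniformSpace R_AbsRing R_NormedModule).
  - apply continuity_pt_filterlim, continuous_clamp.
    intros y Hy; exact (Ck_on_continue_in _ _ _ _ Hf Hy).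
  - apply (@continuous_plus R_UniformSpace R_AbsRing R_NormedModule);
      [apply continuous_const|apply HPc]. }
assert (Hbound : forall t, 0 <= t <= 1 -> Rabs (rem t) <= K * (t - x) ^ 10).
{ intros t Ht; unfold rem; rewrite clamp_id by exact Ht.
  specialize (HT t Ht); rewrite decomp_sum in HT by lia.
  rewrite RPow_abs, (Rabs_pos_eq ((t - x) ^ 10)) in HT
    by (replace 10%nat with (2 * 5)%nat by reflexivity; rewrite pow_mult; apply pow_le, pow2_ge_0).
  rewrite pow_O, Rmult_1_r in HT; exact HT. }
assert (Hsum : forall N n, D_M3 n (fun t => sum_f_R0 (fun r => a (S r) * (t - x) ^ S r) N + rem t) x
   = sum_f_R0 (fun r => a (S r) * D_M3 n (fun t => (t - x) ^ S r) x) N + D_M3 n rem x).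
{ intros N n; induction N as [|N IH].
  - simpl sum_f_R0; apply D_M3_lin; [solve_continuous|exact Hrem].
  - rewrite tech5, Rplus_assoc, (Rplus_comm (a (S (S N)) * _)), <- Rplus_assoc, <- IH, Rplus_comm.
    rewrite <- D_M3_lin.
    + apply D_M3_ext; intros t _; rewrite tech5; ring.
    + solve_continuous.
    + intros t; apply (@continuous_plus R_UniformSpace R_AbsRing R_NormedModule);
        [apply HPc|apply Hrem]. }
assert (E : forall n, (4 <= n)%nat -> D_M3 n f x - f x =
   sum_f_R0 (fun r => a (S r) * D_M3 n (fun t => (t - x) ^ S r) x + 0) 9 + D_M3 n rem x).
{ intros n Hn.
  rewrite (sum_eq _ (fun r => a (S r) * D_M3 n (fun t => (t - x) ^ S r) x))
    by (intros; ring).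
  rewrite <- Hsum, <- Ha.
  rewrite (D_M3_ext n f (fun t => a O * (t - x) ^ 0 + (P t + rem t))).
  - rewrite D_M3_lin, D_M3_one by (exact Hn || solve_continuous ||
      (intros t; apply (@continuous_plus R_UniformSpace R_AbsRing R_NormedModule);
        [apply HPc|apply Hrem])).
    unfold P; ring.
  - intros t Ht; unfold rem; rewrite clamp_id by lra; simpl pow; ring. }
assert (Hzero : cubic (fun _ => 0)) by (exists 0; intros n _; rewrite Rabs_R0; lra).
destruct (cubic_lin 1
   (fun n => sum_f_R0 (fun r => a (S r) * D_M3 n (fun t => (t - x) ^ S r) x + 0) 9)
   (fun n => D_M3 n rem x)) as [M HM].
- apply cubic_sum; intros r Hr.
  apply (cubic_lin (a (S r)) (fun n => D_M3 n (fun t => (t - x) ^ S r) x));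
    [apply D_M3_moment_cubic; lia|exact Hzero].
- now apply D_M3_remainder_cubic with K.
- exists M, 4%nat; split; [lia|]; intros n Hn.
  rewrite E by exact Hn; specialize (HM n Hn); cbv beta in HM; rewrite Rmult_1_l in HM; exact HM.
Qed.
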